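(* Let $Y\ge0$ be an integrable random variable and, for each $k\ge1$, let $X_k$ be a $\Gamma(k,1)$-distributed random variable independent of $Y$. For $k\ge1$ and $t>0$ set $h_k^\times(t)=\mathbb{E}\left\{\frac{Y}{X_k t}\right\}$. Set $$\rho(t)=\mathbb{E}\left\{\frac{Y}{t}\right\}\ (t>0),\qquad A(u)=\int_0^\infty\rho(ut)\,\rho((1-u)t)\,dt\ \ (0<u<1).$$ Then for all integers $m,n\ge0$, $$\left\langle h_{n+1}^\times,h_{m+1}^\times\right\rangle=\int_0^1 B_n^{m+n}(u)\,A(u)\,du,$$ where $B_n^{m+n}(u)=\binom{n+m}{n}u^n(1-u)^m$ is the elementary Bernstein polynomial.
   Context: $\{y\}$ denotes the fractional part of a real number $y$, and $\mathbb{E}$ the expectation (so $\mathbb{E}\{Z\}$ is the expectation of the fractional part of $Z$). The $\Gamma(k,1)$ distribution has density $\frac{1}{\Gamma(k)}x^{k-1}e^{-x}$ on $(0,\infty)$. The scalar product is that of $L^2(0,\infty)$: $\langle f,g\rangle=\int_0^\infty f(t)g(t)\,dt$ for real functions $f,g$. *)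

(* Defs.v *)
From HB Require Import structures.
From mathcomp Require Import all_boot all_order all_algebra.
From mathcomp Require Import all_classical all_reals all_analysis.

Set Implicit Arguments.
Unset Strict Implicit.
Unset Printing Implicit Defensive.

Import Order.TTheory GRing.Theory Num.Theory.
Import numFieldNormedType.Exports.

Local Open Scope classical_set_scope.
Local Open Scope ring_scope.

Section RealFunctions.
Context {R : realType}.
Local Notation mu := (@lebesgue_measure R).

Definition frac_part (y : R) : R := y - (Num.floor y)%:~R.

Definition Gamma (a : R) : R :=
  \int[mu]_(x in `]0, +oo[) (x `^ (a - 1) * expR (- x)).

(* Density of the Gamma(a, 1) distribution (shape a, scale 1). *)
Definition gamma_pdf (a x : R) : R :=
  if 0 < x then (Gamma a)^-1 * (x `^ (a - 1) * expR (- x)) else 0.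

(* B_i^N (u); only meaningful for i <= N, the exponent N - i being truncated. *)
Definition bernstein (N i : nat) (u : R) : R :=
  'C(N, i)%:R * u ^+ i * (1 - u) ^+ (N - i).

Definition in_L2 (f : R -> R) : Prop :=
  measurable_fun (`]0, +oo[ : set R) f /\
  mu.-integrable `]0, +oo[ (fun t => (f t ^+ 2)%:E).

Definition scalar_product (f g : R -> R) : R :=
  \int[mu]_(t in `]0, +oo[) (f t * g t).

End RealFunctions.

Section RandomVariables.
Context d (T : measurableType d) (R : realType) (P : probability T R).

Definition gamma_distributed (a : R) (X : {RV P >-> R}) : Prop :=
  forall S : set R, measurable S ->
    distribution P X S = (\int[lebesgue_measure]_(x in S) (gamma_pdf a x)%:E)%E.

Definition independent_RV (X Y : {RV P >-> R}) : Prop :=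
  forall S S' : set R, measurable S -> measurable S' ->
    P (X @^-1` S `&` Y @^-1` S') = (P (X @^-1` S) * P (Y @^-1` S'))%E.

(* The expectations below are those of [0, 1)-valued variables, hence finite. *)
Definition rho (Y : {RV P >-> R}) (t : R) : R :=
  fine 'E_P[fun w => frac_part (Y w / t)].

Definition htimes (Y : {RV P >-> R}) (X : nat -> {RV P >-> R})
    (k : nat) (t : R) : R :=
  fine 'E_P[fun w => frac_part (Y w / (X k w * t))].

Definition rho_autocorr (Y : {RV P >-> R}) (u : R) : R :=
  \int[lebesgue_measure]_(t in `]0, +oo[) (rho Y (u * t) * rho Y ((1 - u) * t)).

End RandomVariables.

(* Main.v *)
Require Import Defs.
From HB Require Import structures.
From mathcomp Require Import all_boot all_order all_algebra.
From mathcomp Require Import all_classical all_reals all_analysis.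
From mathcomp Require Import measurable_realfun.
From mathcomp Require Import ring lra.

Set Implicit Arguments.
Unset Strict Implicit.
Unset Printing Implicit Defensive.

Import Order.TTheory GRing.Theory Num.Theory.
Import numFieldNormedType.Exports.

Local Open Scope classical_set_scope.
Local Open Scope ring_scope.

(** Everything reduces to one bilinear form in rho.  By independence, and since
    X_(n+1) has density q_n(x) = x^n e^(-x) / n!, the function h_(n+1) is the
    mixture of dilates h_(n+1)(t) = int q_n(x) rho(x t) dx over x > 0
    ([htimesE]).  Both sides of the identity are then equal to
<<
      int int rho(v) rho(w) K(v, w) dv dw     over v, w > 0,
      K(v, w) = C(m+n, n) v^n w^m / (v + w)^(m+n+1).
>>
    For the scalar product ([integral_gamma_mixtureM]), the dilations t = v / x
    and y = w x / v turn the arguments of the two copies of rho into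
    independent variables v and w; what remains in x is a gamma integral, whose
    value is K(v, w).  For the Bernstein side ([integral_bernstein_autocorr]),
    v = u t and w = (1 - u) t are the coordinates along and across the triangle
    0 < v < t, and K is the Bernstein polynomial at u = v / (v + w) divided by
    the Jacobian v + w.

    All integrands are nonnegative, so these manipulations are instances of
    Tonelli's theorem valued in the extended reals, and every convergence claim
    reduces to the finiteness of the form ([bernstein_kernel_form_lty]).  Since
    {y} <= 1 and {y} <= y, one has rho(t) (1 + t) <= 1 + E(Y), hence
    int rho(v) v^(-1/2) dv is finite; and K is bounded by a multiple of
    v^(-1/2) w^(-1/2) because sqrt(v) sqrt(w) <= v + w.  The case m = n gives
    the membership of h_(n+1) in L^2. *)

(** * Measurability and fractional parts *)

Section Measurability.
Context {R : realType}.

Lemma measurable_invr (D : set R) : measurable_fun D (@GRing.inv R).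
Proof.
apply: measurable_funTS.
have -> : @GRing.inv R = fun x => x * (x ^+ 2) `^ (-1).
  apply/funext => x; rewrite powR_inv1 ?sqr_ge0//.
  have [->|x0] := eqVneq x 0; first by rewrite invr0 mul0r.
  by rewrite expr2 invfM mulrA divff// mul1r.
apply: measurable_funM => //.
by apply: (@measurableT_comp _ _ _ _ _ _ (fun y : R => y `^ (-1))).
Qed.

Lemma measurable_funV d (T : measurableType d) (D : set T) (f : T -> R) :
  measurable_fun D f -> measurable_fun D (fun x => (f x)^-1).
Proof. by move=> mf; apply: measurableT_comp => //; exact: measurable_invr. Qed.

Lemma measurable_sqrtr (D : set R) : measurable_fun D (@Num.sqrt R).
Proof.
apply: measurable_funTS.
exact: (continuous_measurable_fun (@sqrt_continuous R)).
Qed.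

Lemma measurable_frac_part (D : set R) : measurable_fun D (@frac_part R).
Proof.
apply: measurable_funTS; apply: measurable_funB => //.
apply: nondecreasing_measurable => // x y xy.
by rewrite ler_int Num.Theory.le_floor.
Qed.

Lemma frac_part_ge0 (x : R) : 0 <= frac_part x.
Proof. by rewrite /frac_part subr_ge0 Num.Theory.floor_le. Qed.

Lemma frac_part_le1 (x : R) : frac_part x <= 1.
Proof.
by rewrite /frac_part lerBlDl -[1]/(1%:~R) -intrD ltW// Num.Theory.floorD1_gt.
Qed.

Lemma frac_part_le (x : R) : 0 <= x -> frac_part x <= x.
Proof. by move=> x0; rewrite /frac_part gerBl ler0z Num.Theory.floor_ge0. Qed.

End Measurability.

Section HalfLine.
Context {R : realType}.

Lemma halflineE (x : R) : (`]0, +oo[%classic : set R) x = (0 < x) :> Prop.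
Proof. by rewrite /= in_itv/= andbT. Qed.

Lemma measurable_halfline : measurable (`]0, +oo[%classic : set R).
Proof. exact: measurable_itv. Qed.

End HalfLine.

Section GammaDensity.
Context {R : realType}.

(** The density of the gamma distribution of shape n+1 on the positive half
    line; shapes are shifted by one so that n is the exponent. *)
Definition gamma_density (n : nat) (x : R) : R := x ^+ n * expR (- x) / n`!%:R.

Lemma gamma_density_ge0 n (x : R) : 0 < x -> 0 <= gamma_density n x.
Proof.
by move=> x0; rewrite /gamma_density divr_ge0// mulr_ge0 ?exprn_ge0 ?expR_ge0 ?ltW.
Qed.

End GammaDensity.

(* The matching is syntactic on purpose: the lemmas applied blindly would unfold
   powers and named functions as products.  Partial applications such as fst,
   ( *%R _) and (+%R _) are what eta-contraction leaves of the sub-goals. *)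
Ltac solve_measurable :=
  repeat match goal with
  | |- measurable_fun _ (EFin \o _) => apply/measurable_EFinP
  | |- measurable_fun _ (fun _ => EFin _) => apply/measurable_EFinP => /=
  | H : measurable_fun setT ?r |- measurable_fun setT ?r => exact: H
  | |- measurable_fun _ (fun _ => ?c) => exact: measurable_cst
  | |- measurable_fun _ (fun x => x) => exact: measurable_id
  | |- measurable_fun _ (fun z => z.1) => exact: measurable_fst
  | |- measurable_fun _ (fun z => z.2) => exact: measurable_snd
  | |- measurable_fun _ (fun x => _ + _) => apply: measurable_funD
  | |- measurable_fun _ (fun x => - _) => apply: measurable_funN
  | |- measurable_fun _ (fun x => _^-1) => apply: measurable_funV
  | |- measurable_fun _ (fun x => _ * _) => apply: measurable_funM
  | |- measurable_fun _ (fun x => _ ^+ _) => apply: measurable_funX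
  | |- measurable_fun _ Num.sqrt => exact: measurable_sqrtr
  | |- measurable_fun _ (fun x => @Num.sqrt ?R0 _) =>
    apply: (@measurableT_comp _ _ _ _ _ _ (@Num.sqrt R0));
    [exact: measurable_sqrtr|]
  | |- measurable_fun ?A (+%R ?a) =>
    apply: (measurable_funD (f := cst a) (g := id))
  | |- measurable_fun _ ( *%R _) => exact: mulrl_measurable
  | |- measurable_fun _ (cst _) => exact: measurable_cst
  | |- measurable_fun _ fst => exact: measurable_fst
  | |- measurable_fun _ snd => exact: measurable_snd
  | |- measurable_fun _ id => exact: measurable_id
  | |- measurable_fun _ (fun x => expR _) =>
    apply: (measurableT_comp (@measurable_expR _))
  | H : measurable_fun setT ?r |- measurable_fun setT (fun x => ?r _) =>
    apply: (measurableT_comp H)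
  end.

Ltac solve_sign :=
  repeat first
  [ assumption
  | match goal with
    | H : forall x, is_true (0 <= ?r x)%R |- is_true (0 <= ?r _)%R => exact: H
    | H : is_true (0 < ?x)%R |- is_true (0 <= ?x)%R => exact: (ltW H)
    | |- is_true (0 <= _ * _)%R => apply: mulr_ge0
    | |- is_true (0 <= _ + _)%R => apply: addr_ge0
    | |- is_true (0 <= _ ^+ _)%R => apply: exprn_ge0
    | |- is_true (0 <= _^-1)%R => rewrite invr_ge0
    | |- is_true (0 <= expR _)%R => exact: expR_ge0
    | |- is_true (0 <= Num.sqrt _)%R => exact: sqrtr_ge0
    | |- is_true (0 <= _%:R)%R => exact: ler0n
    | |- is_true (0 < _ * _)%R => apply: mulr_gt0
    | |- is_true (0 < _ + _)%R => apply: addr_gt0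
    | |- is_true (0 < _ ^+ _)%R => apply: exprn_gt0
    | |- is_true (0 < _^-1)%R => rewrite invr_gt0
    | |- is_true (0 < expR _)%R => exact: expR_gt0
    | |- is_true (0 < Num.sqrt _)%R => rewrite sqrtr_gt0
    | |- is_true (0 < _`!%:R)%R => rewrite ltr0n fact_gt0
    | |- is_true (0 <= gamma_density _ _)%R => apply: gamma_density_ge0
    end ].

(** * Changes of variables and Tonelli's theorem for nonnegative functions *)

Lemma ge0_integral_EFinZl d (T : measurableType d) (R : realType)
    (nu : {measure set T -> \bar R}) (A : set T) (c : R) (f : T -> R) :
  measurable A -> measurable_fun A f -> (forall x, A x -> 0 <= f x) -> 0 <= c ->
  (\int[nu]_(x in A) (c * f x)%:E = c%:E * \int[nu]_(x in A) (f x)%:E)%E.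
Proof. by move=> mA mf f0 c0; rewrite -ge0_integralZl//; exact/measurable_EFinP. Qed.

Section LebesgueAffine.
Context {R : realType}.
Local Notation mu := (@lebesgue_measure R).
Local Open Scope ereal_scope.

Let affine (a b x : R) : measurableTypeR R := (a * x + b)%R.

Let measurable_affine (a b : R) :
  measurable_fun [set: measurableTypeR R] (affine a b).
Proof. by apply: measurable_funD => //; exact: measurable_funM. Qed.

(** The image of Lebesgue measure under x |-> a x + b is a^-1 times Lebesgue
    measure, as one sees on intervals; unlike the substitution lemmas based on
    derivatives, this asks for no continuity of f. *)
Lemma ge0_integral_affine (a b : R) (E : set R) (f : R -> \bar R) :
  (0 < a)%R -> measurable E -> measurable_fun E f ->
  (forall x, E x -> 0 <= f x) ->
  \int[mu]_(x in E) f x =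
    a%:E * \int[mu]_(x in (fun x => a * x + b)%R @^-1` E) f (a * x + b)%R.
Proof.
move=> a0 mE mf f0.
pose af : {mfun measurableTypeR R >-> measurableTypeR R} :=
  HB.pack (affine a b) (isMeasurableFun.Build _ _ _ _ _ (measurable_affine a b)).
pose k := NngNum (ltW a0).
rewrite -[X in _ = _ * X](ge0_integral_pushforward (phi := af))//; last first.
  by move=> x; rewrite inE; exact: f0.
rewrite -[a%:E]/(k%:num%:E) -ge0_integral_mscale//.
apply: eq_measure_integral => //= A mA AE.
apply: lebesgue_measure_unique => //= _ [[c d]] _ <-.
rewrite /mscale/= /pushforward.
have -> : affine a b @^-1` `]c, d] = `]((c - b) / a)%R, ((d - b) / a)%R]%classic.
  apply/seteqP; split => x/=; rewrite !in_itv/= /affine => /andP[h1 h2].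
    by rewrite ltr_pdivrMr// ler_pdivlMr// ltrBlDr lerBrDr mulrC h1.
  move: h1 h2; rewrite ltr_pdivrMr// ler_pdivlMr// ltrBlDr lerBrDr mulrC.
  by move=> -> ->.
rewrite !lebesgue_measure_itv/= !lte_fin ltr_pM2r ?invr_gt0// ltrD2r.
case: ifPn => _; last by rewrite mule0.
by rewrite -!EFinB -EFinM; congr EFin; field; rewrite gt_eqF.
Qed.

Lemma ge0_integral_scale (c : R) (f : R -> \bar R) : (0 < c)%R ->
  measurable_fun (`]0%R, +oo[ : set R) f -> (forall x, (0 < x)%R -> 0 <= f x) ->
  \int[mu]_(x in `]0%R, +oo[) f x =
    c%:E * \int[mu]_(x in `]0%R, +oo[) f (c * x)%R.
Proof.
move=> c0 mf f0; rewrite (@ge0_integral_affine c 0)//; last first.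
  by move=> x /=; rewrite in_itv/= andbT; exact: f0.
congr (_ * _); rewrite (_ : _ @^-1` _ = `]0%R, +oo[%classic).
  by apply: eq_integral => x _; rewrite addr0.
by apply/seteqP; split => x/=; rewrite !in_itv/= !andbT addr0 pmulr_rgt0.
Qed.

Lemma ge0_integral_shift (b : R) (f : R -> \bar R) :
  measurable_fun (`]b, +oo[ : set R) f -> (forall x, (b < x)%R -> 0 <= f x) ->
  \int[mu]_(x in `]b, +oo[) f x = \int[mu]_(x in `]0%R, +oo[) f (x + b)%R.
Proof.
move=> mf f0; rewrite (@ge0_integral_affine 1 b)//; last first.
  by move=> x /=; rewrite in_itv/= andbT; exact: f0.
rewrite mul1e (_ : _ @^-1` _ = `]0%R, +oo[%classic).
  by apply: eq_integral => x _; rewrite mul1r.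
by apply/seteqP; split => x/=; rewrite !in_itv/= !andbT mul1r ltrDr.
Qed.

End LebesgueAffine.

(** Tonelli's theorem on a rectangle, for a function that is nonnegative on that
    rectangle only: extend it by zero. *)
Section Tonelli.
Local Open Scope ereal_scope.
Context d1 d2 (T1 : measurableType d1) (T2 : measurableType d2) (R : realType).
Variables (m1 : {sigma_finite_measure set T1 -> \bar R})
          (m2 : {sigma_finite_measure set T2 -> \bar R}).
Variables (A : set T1) (B : set T2) (f : T1 * T2 -> \bar R).
Hypotheses (mA : measurable A) (mB : measurable B).
Hypotheses (mf : measurable_fun setT f).
Hypothesis f0 : forall x y, A x -> B y -> 0 <= f (x, y).

Let g := f \_ (A `*` B).

Let mg : measurable_fun setT g.
Proof.
apply/(measurable_restrictT _ _).1; first exact: measurableX.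
exact: measurable_funTS.
Qed.

Let g0 z : 0 <= g z.
Proof. by apply: erestrict_ge0 => -[x y] [/= ? ?]; exact: f0. Qed.

Let g_inner x : \int[m2]_y g (x, y) =
  ((fun x => \int[m2]_(y in B) f (x, y)) \_ A) x.
Proof.
rewrite patchE; case: ifPn => xA.
  rewrite [RHS]integral_mkcond; apply: eq_integral => y _.
  by rewrite /g !patchE in_setX xA.
apply: integral0_eq => y _; rewrite /g patchE in_setX (negbTE xA)//.
Qed.

Let g_outer y : \int[m1]_x g (x, y) =
  ((fun y => \int[m1]_(x in A) f (x, y)) \_ B) y.
Proof.
rewrite patchE; case: ifPn => yB.
  rewrite [RHS]integral_mkcond; apply: eq_integral => x _.
  by rewrite /g !patchE in_setX yB andbT.
apply: integral0_eq => x _; rewrite /g patchE in_setX (negbTE yB)// andbF//.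
Qed.

Lemma ge0_fubini_in :
  \int[m1]_(x in A) \int[m2]_(y in B) f (x, y) =
  \int[m2]_(y in B) \int[m1]_(x in A) f (x, y).
Proof.
rewrite integral_mkcond [RHS]integral_mkcond.
transitivity (\int[m1]_x \int[m2]_y g (x, y)).
  by apply: eq_integral => x _; rewrite g_inner.
rewrite (fubini_tonelli (m1 := m1) (m2 := m2) g mg g0).
by apply: eq_integral => y _; rewrite g_outer.
Qed.

Lemma ge0_measurable_fubini_in :
  measurable_fun A (fun x => \int[m2]_(y in B) f (x, y)).
Proof.
apply/(measurable_restrictT _ mA).2.
have <- : (fun x => \int[m2]_y g (x, y)) =
          (fun x => \int[m2]_(y in B) f (x, y)) \_ A.
  by apply/funext => x; rewrite g_inner.
exact: measurable_fun_fubini_tonelli_F.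
Qed.

End Tonelli.

Section Triangle.
Context {R : realType}.
Local Notation mu := (@lebesgue_measure R).
Local Notation D := (`]0%R, +oo[%classic : set R).

Lemma ge0_fubini_triangle (f : R * R -> \bar R) :
  measurable_fun setT f ->
  (forall t v, 0 < v < t -> (0 <= f (t, v))%E) ->
  (\int[mu]_(t in D) \int[mu]_(v in `]0%R, t[) f (t, v) =
   \int[mu]_(v in D) \int[mu]_(t in `]v, +oo[) f (t, v))%E.
Proof.
move=> mf f0.
pose S : set (R * R) := [set z | z.2 < z.1].
have mS : measurable S.
  rewrite -[S]setTI (_ : S = (fun z => z.2 < z.1) @^-1` [set true]); last first.
    by apply/seteqP; split.
  exact: (measurable_fun_ltr measurable_snd measurable_fst).
have mfS : measurable_fun setT (f \_ S).
  by apply: (iffLR (measurable_restrictT f mS)); exact: measurable_funTS.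
transitivity (\int[mu]_(t in D) \int[mu]_(v in D) (f \_ S) (t, v))%E.
  apply: eq_integral => t _.
  have -> : (`]0%R, t[ : set R)%classic = D `&` [set v | v < t].
    apply/seteqP; split => v /=; rewrite !in_itv/= ?andbT; first by move/andP.
    by move=> [-> ->].
  rewrite integral_mkcondr; apply: eq_integral => v _.
  rewrite !patchE; congr (if _ then _ else _).
rewrite (ge0_fubini_in mu mu (f := f \_ S))//; last first.
  move=> t v; rewrite !halflineE => t0 v0; rewrite patchE; case: ifPn => //.
  by rewrite inE => vt; apply: f0; rewrite v0.
apply: eq_integral => v; rewrite inE halflineE => v0.
have -> : (`]v, +oo[ : set R)%classic = D `&` [set t | v < t].
  apply/seteqP; split => t /=; rewrite !in_itv/= !andbT; last by case.
  by move=> vt; split => //; exact: lt_trans vt.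
rewrite integral_mkcondr; apply: eq_integral => t _.
rewrite !patchE; congr (if _ then _ else _).
Qed.

End Triangle.

(** * The gamma integral *)

Section GammaIntegral.
Context {R : realType}.
Local Notation mu := (@lebesgue_measure R).

(** The upper incomplete gamma function of order n+1, that is the integral of
    s^n e^(-s) over s > x, given by the recursion that integration by parts
    yields; it is a primitive of - x^n e^(-x). *)
Fixpoint gamma_tail (n : nat) (x : R) : R :=
  if n is k.+1 then x ^+ n * expR (- x) + n%:R * gamma_tail k x
  else expR (- x).

Lemma is_derive_gamma_tail n (x : R) :
  is_derive x 1 (gamma_tail n) (- (x ^+ n * expR (- x))).
Proof.
have de : is_derive x 1 (fun x : R => expR (- x)) (- expR (- x)).
  have -> : (fun x : R => expR (- x)) = (expR \o -%R) by [].
  by apply: is_derive_eq; rewrite mulrN1.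
elim: n => [|n IH] /=; first by rewrite mul1r.
have dX : is_derive x 1 (fun x : R => x ^+ n.+1) (n.+1%:R * x ^+ n).
  have -> : (fun x : R => x ^+ n.+1) = (@id R) ^+ n.+1.
    by apply/funext => y; rewrite fctE.
  by apply: is_derive_eq; rewrite /GRing.scale/= mulr1.
have := is_deriveD (is_deriveM dX de) (is_deriveZ n.+1%:R IH).
move=> /is_derive_eq; apply.
by rewrite /GRing.scale/= exprS; ring.
Qed.

(** One term of the exponential series suffices: x^(n+1) / (n+1)! <= e^x. *)
Lemma expnMexpN_cvg0 n : (x ^+ n * expR (- x) : R) @[x --> +oo] --> (0 : R).
Proof.
apply: (@squeeze_cvgr _ _ _ _ (cst 0) (fun x : R => (n.+1)`!%:R * x^-1)).
- near=> x.
  have x0 : 0 < x by near: x; exact: nbhs_pinfty_gt.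
  apply/andP; split; first by rewrite mulr_ge0 ?exprn_ge0 ?expR_ge0 ?ltW.
  rewrite expRN ler_pdivrMr ?expR_gt0// mulrAC ler_pdivlMr// -exprSr.
  have f0 : (0 : R) < (n.+1)`!%:R by rewrite ltr0n fact_gt0.
  rewrite -ler_pdivrMl// mulrC (le_trans _ (expR_ge1Dxn n (ltW x0)))//.
  by rewrite lerDr.
- exact: cvg_cst.
- rewrite -[X in _ --> X](mulr0 (n.+1)`!%:R); apply: cvgMl_tmp.
  apply/gtr0_cvgV0; last exact: cvg_id.
  exact: nbhs_pinfty_gt.
Unshelve. all: by end_near.
Qed.

Lemma gamma_tail_cvg0 n : gamma_tail n x @[x --> +oo] --> (0 : R).
Proof.
elim: n => [|n IH] /=; first exact: cvgr_expR.
rewrite -[X in _ --> X](addr0 0) -[X in _ --> _ + X](mulr0 n.+1%:R).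
by apply: cvgD; [exact: (expnMexpN_cvg0 n.+1)|exact: cvgMl_tmp].
Qed.

Lemma gamma_tail0 n : gamma_tail n 0 = n`!%:R.
Proof.
elim: n => [|n IH] /=; first by rewrite oppr0 expR0.
by rewrite expr0n/= mul0r add0r IH factS natrM.
Qed.

Lemma integral_expnMexpN n :
  (\int[mu]_(x in `]0%R, +oo[) (x ^+ n * expR (- x))%:E = (n`!%:R)%:E)%E.
Proof.
have dt (x : R) := is_derive_gamma_tail n x.
have cq : continuous (fun x : R => x ^+ n * expR (- x)).
  move=> x; apply: cvgM; first exact: exprn_continuous.
  by apply: continuous_comp; [exact: opp_continuous|exact: continuous_expR].
rewrite integral_itv_obnd_cbnd; last first.
  by apply/measurable_EFinP; apply: measurable_funTS; exact: continuous_measurable_fun.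
rewrite (@ge0_continuous_FTC2y _ _ (fun x => - gamma_tail n x) _ 0).
- by rewrite -EFinB gamma_tail0 sub0r opprK.
- by move=> x x0; rewrite mulr_ge0 ?exprn_ge0 ?expR_ge0.
- exact: continuous_subspaceT.
- by rewrite -oppr0; apply: cvgN; exact: gamma_tail_cvg0.
- by move=> x _; apply: derivableN; apply: ex_derive.
- apply: cvgN; apply: cvg_at_right_filter.
  apply: differentiable_continuous; apply/derivable1_diffP.
  by apply: ex_derive.
- move=> x _; rewrite derive1E deriveN; last by apply: ex_derive.
  by rewrite derive_val opprK.
Qed.

Lemma GammaS n : Gamma (n.+1%:R : R) = n`!%:R.
Proof.
rewrite /Gamma /Rintegral -[RHS]/(fine (n`!%:R)%:E) -integral_expnMexpN.
congr fine; apply: eq_integral => x; rewrite inE/= in_itv/= andbT => x0.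
by rewrite -[n.+1%:R]natr1 addrK powR_mulrn// ltW.
Qed.

Lemma measurable_gamma_density n : measurable_fun setT (@gamma_density R n).
Proof. by rewrite /gamma_density; solve_measurable. Qed.

Lemma integral_expnMexpZ n (c : R) : 0 < c ->
  (\int[mu]_(x in `]0%R, +oo[) (x ^+ n * expR (- (c * x)))%:E =
   (n`!%:R / c ^+ n.+1)%:E)%E.
Proof.
move=> c0.
have h : (\int[mu]_(x in `]0%R, +oo[)
   (c ^+ n.+1 * (x ^+ n * expR (- (c * x))))%:E = (n`!%:R)%:E)%E.
  rewrite -integral_expnMexpN [RHS](ge0_integral_scale c0).
  - rewrite -ge0_integralZl//.
    + by apply: eq_integral => x _; rewrite -EFinM exprMn exprS; congr EFin; ring.
    + by apply: measurable_funTS; solve_measurable.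
    + by move=> x; rewrite halflineE => x0; rewrite lee_fin; solve_sign.
    + by rewrite lee_fin ltW.
  - by apply: measurable_funTS; solve_measurable.
  - by move=> x x0; rewrite lee_fin; solve_sign.
rewrite EFinM -h ge0_integral_EFinZl//.
- by rewrite muleC muleA -EFinM mulVf ?mul1e// gt_eqF// exprn_gt0.
- by apply: measurable_funTS; solve_measurable.
- by move=> x; rewrite halflineE => x0; solve_sign.
- by rewrite exprn_ge0// ltW.
Qed.

End GammaIntegral.

(** * The scalar product as a bilinear form *)

Section BilinearForm.
Context {R : realType}.
Local Notation mu := (@lebesgue_measure R).
Local Notation D := (`]0%R, +oo[%classic : set R).

(** The Bernstein polynomial at u = v / (v + w), divided by v + w. *)
Definition bernstein_kernel (n m : nat) (v w : R) : R :=
  'C(m + n, n)%:R * v ^+ n * w ^+ m / (v + w) ^+ (m + n).+1.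

Section GammaMixtures.
Variables (r : R -> R) (n m : nat) (hn hm : R -> R).
Hypotheses (mr : measurable_fun setT r) (r0 : forall x, 0 <= r x).
Hypotheses (mhm : measurable_fun setT hm) (hm0 : forall x, 0 <= hm x).
Hypothesis hnE : forall t, 0 < t ->
  ((hn t)%:E = \int[mu]_(x in D) (gamma_density n x * r (x * t))%:E)%E.
Hypothesis hmE : forall t, 0 < t ->
  ((hm t)%:E = \int[mu]_(x in D) (gamma_density m x * r (x * t))%:E)%E.

Let mq k := @measurable_gamma_density R k.

(** After collecting powers of x the integrand is x^(m+n) e^(-c x) with
    c = (v + w) / v, which is where the power of v + w comes from. *)
Lemma integral_gamma_densityM (v w : R) : 0 < v -> 0 < w ->
  (\int[mu]_(x in D) (v^-1 * gamma_density n x * r v *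
      gamma_density m (x / v * w) * r w)%:E =
   (r v * r w * bernstein_kernel n m v w)%:E)%E.
Proof.
move=> v0 w0.
have c0 : 0 < (v + w) / v by rewrite divr_gt0// addr_gt0.
pose k := v^-1 * r v * r w * (w / v) ^+ m / (n`!%:R * m`!%:R).
transitivity (\int[mu]_(x in D)
    (k * (x ^+ (m + n) * expR (- ((v + w) / v * x))))%:E)%E.
  apply: eq_integral => x _; congr EFin.
  have -> : (v + w) / v * x = x + x / v * w by field; rewrite gt_eqF.
  rewrite /gamma_density /k opprD expRD exprD !exprMn.
  field.
  by rewrite !gt_eqF// ltr0n fact_gt0.
rewrite ge0_integral_EFinZl//.
- rewrite integral_expnMexpZ// -EFinM; congr EFin.
  have -> : (m + n)`!%:R = 'C(m + n, n)%:R * (n`!%:R * m`!%:R) :> R.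
    by rewrite -!natrM -(bin_fact (leq_addl m n)) addnK.
  rewrite /k /bernstein_kernel !expr_div_n [v ^+ (m + n).+1]exprS exprD.
  field.
  by rewrite !gt_eqF ?exprn_gt0 ?addr_gt0 ?ltr0n ?fact_gt0.
- by apply: measurable_funTS; solve_measurable.
- by move=> x; rewrite halflineE => x0; solve_sign.
- by rewrite /k; solve_sign.
Qed.

(** Only dilations are needed: hn is expanded first and t is replaced by v / x;
    expanding hm at v / x and replacing its variable by (x / v) w then separates
    v and w from x. *)
Lemma integral_gamma_mixtureM :
  (\int[mu]_(t in D) (hn t * hm t)%:E =
   \int[mu]_(v in D) \int[mu]_(w in D)
      (r v * r w * bernstein_kernel n m v w)%:E)%E.
Proof.
transitivity (\int[mu]_(x in D) \int[mu]_(v in D)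
    (x^-1 * gamma_density n x * r v * hm (v / x))%:E)%E.
  transitivity (\int[mu]_(t in D) \int[mu]_(x in D)
      (gamma_density n x * r (x * t) * hm t)%:E)%E.
    apply: eq_integral => t; rewrite inE halflineE => t0.
    rewrite mulrC EFinM hnE// -ge0_integral_EFinZl//.
    - by apply: eq_integral => x _; rewrite mulrC.
    - by apply: measurable_funTS; have mqn := mq n; solve_measurable.
    - by move=> x; rewrite halflineE => x0; solve_sign.
  rewrite (ge0_fubini_in mu mu (f := fun z : R * R =>
    (gamma_density n z.2 * r (z.2 * z.1) * hm z.1)%:E))//=; last 2 first.
  - by have mqn := mq n; solve_measurable.
  - move=> t x; rewrite !in_itv/= !andbT => t0 x0.
    by rewrite lee_fin; solve_sign.
  apply: eq_integral => x; rewrite inE halflineE => x0.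
  rewrite [RHS](ge0_integral_scale x0); last 2 first.
  - by apply: measurable_funTS; solve_measurable.
  - move=> v v0.
    by rewrite lee_fin; solve_sign.
  rewrite -ge0_integral_EFinZl//; last 3 first.
  - by apply: measurable_funTS; solve_measurable.
  - move=> v; rewrite halflineE => v0.
    by solve_sign.
  - exact: ltW.
  apply: eq_integral => t _; congr EFin.
  rewrite (_ : x * t / x = t); last by field; rewrite gt_eqF.
  by field; rewrite gt_eqF.
rewrite (ge0_fubini_in mu mu (f := fun z : R * R =>
    (z.1^-1 * gamma_density n z.1 * r z.2 * hm (z.2 / z.1))%:E))//=; last 2 first.
- by have mqn := mq n; solve_measurable.
- move=> x v; rewrite !in_itv/= !andbT => x0 v0.
  by rewrite lee_fin; solve_sign.
apply: eq_integral => v; rewrite inE halflineE => v0.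
transitivity (\int[mu]_(x in D) \int[mu]_(w in D)
    (v^-1 * gamma_density n x * r v * gamma_density m (x / v * w) * r w)%:E)%E.
  apply: eq_integral => x; rewrite inE halflineE => x0.
  have xv0 : 0 < x / v by rewrite divr_gt0.
  rewrite EFinM hmE ?divr_gt0//.
  rewrite (ge0_integral_scale xv0); last 2 first.
  - by apply: measurable_funTS; have mqm := mq m; solve_measurable.
  - by move=> y y0; rewrite lee_fin; solve_sign.
  rewrite muleA -EFinM -ge0_integral_EFinZl//; last 3 first.
  - by apply: measurable_funTS; have mqm := mq m; solve_measurable.
  - by move=> w; rewrite halflineE => w0; solve_sign.
  - by solve_sign.
  apply: eq_integral => w _; congr EFin.
  rewrite (_ : x / v * w * (v / x) = w); last first.
    by field; rewrite !gt_eqF.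
  by field; rewrite !gt_eqF.
rewrite (ge0_fubini_in mu mu (f := fun z : R * R => (v^-1 * gamma_density n z.1 * r v *
    gamma_density m (z.1 / v * z.2) * r z.2)%:E))//=; last 2 first.
- by have mqn := mq n; have mqm := mq m; solve_measurable.
- move=> x w; rewrite !in_itv/= !andbT => x0 w0.
  by rewrite lee_fin; solve_sign.
by apply: eq_integral => w; rewrite inE halflineE; exact: integral_gamma_densityM.
Qed.

End GammaMixtures.

End BilinearForm.

(** * The Bernstein integral as the same form *)

Section BernsteinSide.
Context {R : realType}.
Local Notation mu := (@lebesgue_measure R).
Local Notation D := (`]0%R, +oo[%classic : set R).

Variables (r : R -> R).
Hypotheses (mr : measurable_fun setT r) (r0 : forall x, 0 <= r x).

Lemma measurable_bernstein N i : measurable_fun setT (@bernstein R N i).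
Proof. by rewrite /bernstein; solve_measurable. Qed.

Lemma bernstein_ge0 N i (u : R) : 0 < u < 1 -> 0 <= bernstein N i u.
Proof.
move=> /andP[u0 u1]; have u1' : 0 < 1 - u by rewrite subr_gt0.
by rewrite /bernstein; solve_sign.
Qed.

(** For fixed t, the dilation v = u t maps 0 < u < 1 onto 0 < v < t; once the
    triangle is read with v first, w = t - v runs over the half line. *)
Lemma integral_bernstein_autocorr (n m : nat) :
  (\int[mu]_(u in `]0%R, 1%R[) \int[mu]_(t in D)
     (bernstein (m + n) n u * (r (u * t) * r ((1 - u) * t)))%:E =
   \int[mu]_(v in D) \int[mu]_(w in D)
     (r v * r w * bernstein_kernel n m v w)%:E)%E.
Proof.
have mB := measurable_bernstein (m + n) n.
pose G (z : R * R) : \bar R := (z.1^-1 * (bernstein (m + n) n (z.2 / z.1) *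
  (r z.2 * r (z.1 - z.2))))%:E.
have mG : measurable_fun setT G by rewrite /G; solve_measurable.
have G0 t v : 0 < v < t -> (0 <= G (t, v))%E.
  move=> /andP[v0 vt]; have t0 := lt_trans v0 vt.
  rewrite lee_fin /=; solve_sign.
  by rewrite bernstein_ge0// divr_gt0//= ltr_pdivrMr// mul1r.
rewrite (ge0_fubini_in mu mu (f := fun z : R * R =>
  (bernstein (m + n) n z.1 * (r (z.1 * z.2) * r ((1 - z.1) * z.2)))%:E))//=;
  last 2 first.
- by solve_measurable.
- move=> u t; rewrite !in_itv/= => u01 _.
  by rewrite lee_fin; solve_sign; exact: bernstein_ge0.
transitivity (\int[mu]_(t in D) \int[mu]_(v in `]0%R, t[) G (t, v))%E.
  apply: eq_integral => t; rewrite inE halflineE => t0.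
  have tV0 : 0 < t^-1 by rewrite invr_gt0.
  rewrite (@ge0_integral_affine R t^-1 0 `]0, 1[)//; last 2 first.
  - by apply: measurable_funTS; solve_measurable.
  - by move=> u /=; rewrite in_itv/= => u01; rewrite lee_fin; solve_sign;
      exact: bernstein_ge0.
  have -> : (fun x : R => t^-1 * x + 0) @^-1` `]0, 1[ = `]0, t[%classic.
    apply/seteqP; split => x /=; rewrite !in_itv/= addr0 pmulr_rgt0//;
    by rewrite mulrC ltr_pdivrMr// mul1r.
  rewrite -ge0_integralZl//.
  - apply: eq_integral => v _; rewrite -EFinM /G/=; congr (_ * _)%:E.
    rewrite addr0; congr (_ _ _ _ * (r _ * r _)); field; exact: lt0r_neq0.
  - by apply: measurable_funTS; solve_measurable.
  - move=> v /=; rewrite in_itv/= => /andP[v0 vt]; rewrite lee_fin; solve_sign.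
    by rewrite bernstein_ge0// addr0 mulr_gt0//= mulrC ltr_pdivrMr// mul1r.
  - by rewrite lee_fin ltW.
rewrite ge0_fubini_triangle//.
apply: eq_integral => v; rewrite inE halflineE => v0.
rewrite ge0_integral_shift//; last 2 first.
- exact/measurable_funTS/measurableT_comp.
- by move=> t vt; apply: G0; rewrite v0.
apply: eq_integral => w; rewrite inE halflineE => w0; congr EFin => /=.
rewrite /bernstein_kernel /bernstein addrK addnK.
have wv0 : w + v != 0 by rewrite gt_eqF//; solve_sign.
have -> : 1 - v / (w + v) = w / (w + v) by field.
rewrite !expr_div_n [v + w]addrC exprS exprD; field.
by rewrite !expf_neq0.
Qed.

End BernsteinSide.

(** * Finiteness of the form *)

Section Finiteness.
Context {R : realType}.
Local Notation mu := (@lebesgue_measure R).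
Local Notation D := (`]0%R, +oo[%classic : set R).

(** The derivative of - (1 + sqrt x)^-1: a function comparable to
    x^(-1/2) / (1 + x) whose primitive is explicit. *)
Definition sqrt_decay (x : R) : R :=
  (2 * Num.sqrt x * (1 + Num.sqrt x) ^+ 2)^-1.

Lemma sqrt_decay_ge0 (x : R) : 0 <= sqrt_decay x.
Proof. by rewrite /sqrt_decay; solve_sign. Qed.

Lemma measurable_sqrt_decay : measurable_fun setT sqrt_decay.
Proof. by rewrite /sqrt_decay; solve_measurable. Qed.

Let is_derive_primitive (x : R) : 0 < x ->
  is_derive x 1 (fun x => - (1 + Num.sqrt x)^-1) (sqrt_decay x).
Proof.
move=> x0.
have s0 : 0 < Num.sqrt x by rewrite sqrtr_gt0.
have d1 : is_derive x 1 (fun x : R => 1 + Num.sqrt x) (2 * Num.sqrt x)^-1.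
  rewrite -[X in is_derive _ _ _ X]add0r.
  exact: (is_deriveD (is_derive_cst (1 : R) x 1) (is_derive1_sqrt x0)).
have d2 : 1 + Num.sqrt x != 0 by rewrite gt_eqF// addr_gt0.
have := is_deriveN (is_deriveV (f := fun x => 1 + Num.sqrt x) d2 d1).
move=> /is_derive_eq; apply.
by rewrite /GRing.scale/= mulNr opprK /sqrt_decay [RHS]invfM mulrC.
Qed.

Let sqrt_cvgy : (1 + Num.sqrt x : R) @[x --> +oo] --> +oo.
Proof.
apply/cvgryPge => A; near=> x.
have : A ^+ 2 <= x by near: x; apply: nbhs_pinfty_ge; exact: num_real.
move=> /ler_wsqrtr; rewrite sqrtr_sqr => h.
by rewrite (le_trans (ler_norm A))// (le_trans h)// lerDr.
Unshelve. all: by end_near. Qed.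

Lemma integral_sqrt_decay_tail (a : R) : 0 < a ->
  (\int[mu]_(x in `[a, +oo[) (sqrt_decay x)%:E = ((1 + Num.sqrt a)^-1)%:E)%E.
Proof.
move=> a0.
rewrite (@ge0_continuous_FTC2y _ _ (fun x => - (1 + Num.sqrt x)^-1) _ 0).
- by rewrite -EFinB sub0r opprK.
- by move=> x _; exact: sqrt_decay_ge0.
- apply: continuous_in_subspaceT => x; rewrite inE/= in_itv/= andbT => ax.
  have s0 : 0 < Num.sqrt x by rewrite sqrtr_gt0 (lt_le_trans a0).
  apply: cvgV; first by rewrite gt_eqF//; solve_sign.
  apply: cvgM; first by apply: cvgMl_tmp; exact: sqrt_continuous.
  by apply: cvgM; apply: cvgD; (exact: cvg_cst || exact: sqrt_continuous).
- rewrite -oppr0; apply: cvgN; apply/gtr0_cvgV0 => //.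
  by near=> x; rewrite ltr_pwDl.
- by move=> x ax; have := is_derive_primitive (lt_trans a0 ax) => -[].
- apply: cvg_at_right_filter.
  by have [/derivable1_diffP/differentiable_continuous] := is_derive_primitive a0.
- move=> x; rewrite in_itv/= andbT => ax.
  by rewrite derive1E; apply: derive_val; exact: is_derive_primitive (lt_trans a0 ax).
Unshelve. all: by end_near. Qed.

(** The integrand blows up at 0, so the fundamental theorem is applied on
    [a, +oo[ with a = 1 / (k + 1) and k tends to infinity. *)
Lemma integral_sqrt_decay_le1 : (\int[mu]_(x in D) (sqrt_decay x)%:E <= 1)%E.
Proof.
pose F (k : nat) : set R := `[k.+1%:R^-1, +oo[%classic.
have DF : D = \bigcup_k F k.
  apply/seteqP; split => x /=; rewrite in_itv/= andbT.
    move=> x0; exists (Num.bound x^-1) => //=; rewrite /F/= in_itv/= andbT.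
    rewrite invf_ple ?posrE// ltW// (lt_trans (archi_boundP _)) ?ltr_nat//.
    by rewrite invr_ge0 ltW.
  by case=> k _; rewrite /F/= in_itv/= andbT; exact: lt_le_trans.
have h : (\int[mu]_(x in F k) (sqrt_decay x)%:E @[k --> \oo] -->
    \int[mu]_(x in \bigcup_k F k) (sqrt_decay x)%:E)%E.
  apply: ge0_nondecreasing_set_cvg_integral.
  - apply/nondecreasing_seqP => k; rewrite subsetEset => x.
    rewrite /F/= !in_itv/= !andbT; apply: le_trans.
    by rewrite lef_pV2 ?posrE// ler_nat.
  - by move=> k; exact: measurable_itv.
  - by move=> k; apply/measurable_EFinP/measurable_funTS; exact: measurable_sqrt_decay.
  - by move=> k x _; rewrite lee_fin sqrt_decay_ge0.
rewrite DF -(cvg_lim _ h)//; apply: lime_le; first by apply/cvg_ex; eexists; exact: h.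
apply: nearW => k; rewrite integral_sqrt_decay_tail// lee_fin invf_le1 ?ltr_pwDl//.
by rewrite lerDl.
Qed.

Variables (r : R -> R) (c : R).
Hypotheses (mr : measurable_fun setT r) (r0 : forall x, 0 <= r x).
Hypothesis r_decay : forall x, 0 < x -> r x * (1 + x) <= c.

Let c0 : 0 <= c.
Proof. by apply: le_trans (r_decay ltr01); solve_sign. Qed.

(** Compare with [sqrt_decay]: (1 + sqrt x)^2 <= 2 (1 + x). *)
Lemma integral_div_sqrt_lty : (\int[mu]_(x in D) (r x / Num.sqrt x)%:E < +oo)%E.
Proof.
apply: (@le_lt_trans _ _ (\int[mu]_(x in D) ((4 * c) * sqrt_decay x)%:E)%E).
  apply: ge0_le_integral => //.
  - by move=> x _; rewrite lee_fin; solve_sign.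
  - by apply: measurable_funTS; solve_measurable.
  - by apply: measurable_funTS; have ms := measurable_sqrt_decay; solve_measurable.
  - move=> x; rewrite halflineE => x0; rewrite lee_fin /sqrt_decay.
    have s0 : 0 < Num.sqrt x by rewrite sqrtr_gt0.
    have := r_decay x0; rewrite -[X in 1 + X](sqr_sqrtr (ltW x0)).
    have := r0 x; move: s0; set q := r x; set s := Num.sqrt x => s0 q0 h.
    have s1 : 0 < (1 + s) ^+ 2 by solve_sign.
    rewrite -subr_ge0.
    have -> : 4 * c / (2 * s * (1 + s) ^+ 2) - q / s =
        (2 * c - q * (1 + s) ^+ 2) / (s * (1 + s) ^+ 2).
      by field; rewrite !gt_eqF// addr_gt0.
    have q1 : 0 <= q * (1 - s) ^+ 2 by rewrite mulr_ge0// sqr_ge0.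
    by apply: divr_ge0; [nra|solve_sign].
rewrite ge0_integral_EFinZl//.
- rewrite (@le_lt_trans _ _ ((4 * c)%:E * 1)%E) ?mule1 ?ltry//.
  by rewrite -[leRHS]mule1 lee_wpmul2l ?lee_fin ?integral_sqrt_decay_le1 ?mulr_ge0.
- by apply: measurable_funTS; exact: measurable_sqrt_decay.
- by move=> x _; exact: sqrt_decay_ge0.
- by rewrite mulr_ge0.
Qed.

(** v^n w^m <= (v + w)^(m+n) and sqrt v * sqrt w <= v + w.  The bound is a
    product of a function of v and a function of w with the same homogeneity as
    the kernel, so that the double integral below factors. *)
Lemma bernstein_kernel_le n m (v w : R) : 0 < v -> 0 < w ->
  bernstein_kernel n m v w <=
  'C(m + n, n)%:R * ((Num.sqrt v)^-1 * (Num.sqrt w)^-1).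
Proof.
move=> v0 w0.
have sv : 0 < Num.sqrt v by rewrite sqrtr_gt0.
have sw : 0 < Num.sqrt w by rewrite sqrtr_gt0.
have vw : 0 < v + w by solve_sign.
rewrite /bernstein_kernel -!mulrA ler_wpM2l//.
have h1 : v ^+ n * w ^+ m <= (v + w) ^+ (m + n).
  rewrite exprD mulrC; apply: ler_pM; [by solve_sign|by solve_sign| |].
    by apply: lerXn2r; rewrite ?nnegrE ?ltW// ltrDr.
  by apply: lerXn2r; rewrite ?nnegrE ?ltW// ltrDl.
have h2 : Num.sqrt v * Num.sqrt w <= v + w.
  have := sqr_ge0 (Num.sqrt v - Num.sqrt w); have := sqr_sqrtr (ltW v0).
  by have := sqr_sqrtr (ltW w0); have := mulr_gt0 sv sw; nra.
rewrite mulrA ler_pdivrMr ?exprn_gt0// -invfM ler_pdivlMl ?mulr_gt0//.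
by rewrite exprS; apply: ler_pM => //; solve_sign.
Qed.

Lemma bernstein_kernel_form_lty n m :
  (\int[mu]_(v in D) \int[mu]_(w in D)
     (r v * r w * bernstein_kernel n m v w)%:E < +oo)%E.
Proof.
pose J := (\int[mu]_(x in D) (r x / Num.sqrt x)%:E)%E.
have J0 : (0 <= J)%E by apply: integral_ge0 => x _; rewrite lee_fin; solve_sign.
have Jfin : J \is a fin_num by rewrite ge0_fin_numE// integral_div_sqrt_lty.
pose b : R := 'C(m + n, n)%:R.
have b0 : 0 <= b by rewrite ler0n.
have mK : measurable_fun setT (fun z : R * R =>
    (r z.1 * r z.2 * bernstein_kernel n m z.1 z.2)%:E).
  by rewrite /bernstein_kernel; solve_measurable.
have K0 v w : 0 < v -> 0 < w -> 0 <= r v * r w * bernstein_kernel n m v w.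
  by move=> v0 w0; rewrite /bernstein_kernel; solve_sign.
apply: (@le_lt_trans _ _ (\int[mu]_(v in D) (b * fine J * (r v / Num.sqrt v))%:E)%E).
  apply: ge0_le_integral => //.
  - move=> v; rewrite halflineE => v0; apply: integral_ge0 => w; rewrite halflineE => w0.
    by rewrite lee_fin K0.
  - apply: (ge0_measurable_fubini_in mu measurable_halfline measurable_halfline mK).
    move=> v w; rewrite !halflineE => v0 w0.
    by rewrite lee_fin K0.
  - by apply: measurable_funTS; solve_measurable.
  - move=> v; rewrite halflineE => v0.
    have -> : ((b * fine J * (r v / Num.sqrt v))%:E =
        \int[mu]_(w in D) (b * (r v / Num.sqrt v) * (r w / Num.sqrt w))%:E)%E.
      rewrite ge0_integral_EFinZl//.
      + by rewrite -/J -[X in (_ * X)%E](fineK Jfin) -EFinM; congr EFin; ring.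
      + by apply: measurable_funTS; solve_measurable.
      + by move=> w _; solve_sign.
      + by solve_sign.
    apply: ge0_le_integral => //.
    + by move=> w; rewrite halflineE => w0; rewrite lee_fin K0.
    + by apply: measurable_funTS; rewrite /bernstein_kernel; solve_measurable.
    + by apply: measurable_funTS; solve_measurable.
    + move=> w; rewrite halflineE => w0; rewrite lee_fin.
      have := bernstein_kernel_le n m v0 w0.
      move=> /(ler_wpM2l (mulr_ge0 (r0 v) (r0 w))) h; apply: le_trans h _.
      by rewrite le_eqVlt; apply/orP; left; apply/eqP; rewrite /b; ring.
rewrite ge0_integral_EFinZl//.
- by rewrite -/J -(fineK Jfin) -EFinM ltry.
- by apply: measurable_funTS; solve_measurable.
- by move=> w _; solve_sign.
- by rewrite mulr_ge0// fine_ge0.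
Qed.

(** The decay of r also gives r(s) sqrt(s) <= c; writing sqrt(u t) in terms of
    sqrt((1 - u) t) bounds the product by a multiple of r(u t) / sqrt(u t). *)
Lemma integrable_autocorr (u : R) : 0 < u < 1 ->
  mu.-integrable D (fun t => (r (u * t) * r ((1 - u) * t))%:E).
Proof.
move=> /andP[u0 u1]; have u1' : 0 < 1 - u by rewrite subr_gt0.
apply/integrableP; split; first by apply: measurable_funTS; solve_measurable.
pose k' := Num.sqrt u * (c / Num.sqrt (1 - u)).
have su : 0 < Num.sqrt u by rewrite sqrtr_gt0.
have su1 : 0 < Num.sqrt (1 - u) by rewrite sqrtr_gt0.
have k0 : 0 <= k' by rewrite /k'; solve_sign.
apply: (@le_lt_trans _ _
    (\int[mu]_(t in D) (k' * (r (u * t) / Num.sqrt (u * t)))%:E)%E).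
  apply: ge0_le_integral => //.
  - by apply: measurable_funTS; apply: measurableT_comp => //; solve_measurable.
  - by apply: measurable_funTS; solve_measurable.
  - move=> t; rewrite halflineE => t0; rewrite /= ger0_norm; last by solve_sign.
    have st : 0 < Num.sqrt t by rewrite sqrtr_gt0.
    rewrite lee_fin sqrtrM ?(ltW u0)// /k'.
    have t1 : 0 < (1 - u) * t by solve_sign.
    have := r_decay t1.
    have h : Num.sqrt ((1 - u) * t) <= 1 + (1 - u) * t.
      have := sqr_sqrtr (ltW t1); set s := Num.sqrt _ => <-; nra.
    move=> hc.
    have h1 : r ((1 - u) * t) * (Num.sqrt (1 - u) * Num.sqrt t) <= c.
      by rewrite -sqrtrM ?(ltW u1')//; apply: le_trans hc; rewrite ler_wpM2l.
    have h2 := ler_wpM2l (r0 (u * t)) h1.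
    have -> : Num.sqrt u * (c / Num.sqrt (1 - u)) *
       (r (u * t) / (Num.sqrt u * Num.sqrt t)) =
       r (u * t) * c / (Num.sqrt (1 - u) * Num.sqrt t).
      by field; rewrite !gt_eqF.
    by rewrite ler_pdivlMr ?mulr_gt0// -mulrA.
rewrite ge0_integral_EFinZl//.
- have := integral_div_sqrt_lty; rewrite (ge0_integral_scale u0).
  + rewrite -lte_pdivlMl// => h; rewrite lte_mul_pinfty ?lee_fin//.
    by apply: lt_le_trans h _; rewrite leey.
  + by apply: measurable_funTS; solve_measurable.
  + by move=> x _; rewrite lee_fin; solve_sign.
- by apply: measurable_funTS; solve_measurable.
- by move=> w _; solve_sign.
Qed.

End Finiteness.

(** * Densities and independence *)

Section Density.
Local Open Scope ereal_scope.
Context d (T : measurableType d) (R : realType).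
Variables (mu nu : {measure set T -> \bar R}) (g : T -> R).
Hypotheses (mg : measurable_fun setT g) (g0 : forall x, (0 <= g x)%R).
Hypothesis nuE : forall A, measurable A -> nu A = \int[mu]_(x in A) (g x)%:E.

Import HBNNSimple.

(** By additivity and monotone convergence from the defining case of indicator
    functions. *)
Lemma ge0_integral_density (f : T -> \bar R) :
  measurable_fun setT f -> (forall x, 0 <= f x) ->
  \int[nu]_x f x = \int[mu]_x (f x * (g x)%:E).
Proof.
move=> mf f0; pose h := nnsfun_approx measurableT mf.
have hf x : (h n x)%:E @[n --> \oo] --> f x by exact: cvg_nnsfun_approx.
have ndh x : {homo (fun n => h n x) : m n / (m <= n)%N >-> (m <= n)%R}.
  by move=> m n mn; exact/lefP/nd_nnsfun_approx.
transitivity (limn (fun n => \int[nu]_x (h n x)%:E)).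
  rewrite -monotone_convergence//.
  - by apply: eq_integral => x _; apply/esym/cvg_lim => //; exact: hf.
  - by move=> n; exact/measurable_EFinP.
  - by move=> n x _; rewrite lee_fin.
  - by move=> x _ m n mn; rewrite lee_fin ndh.
transitivity (limn (fun n => \int[mu]_x ((h n x)%:E * (g x)%:E))); last first.
  rewrite -monotone_convergence//.
  - apply: eq_integral => x _; apply/cvg_lim => //.
    by apply: cvgeZr => //; exact: hf.
  - by move=> n; apply: emeasurable_funM; exact/measurable_EFinP.
  - by move=> n x _; rewrite mule_ge0 ?lee_fin.
  - by move=> x _ m n mn; rewrite lee_wpmul2r ?lee_fin ?ndh.
congr (limn _); apply/funext => n.
have mi r : measurable (h n @^-1` [set r]) by exact: measurable_sfunP.
transitivity (\sum_(r \in range (h n)) \int[nu]_x (r * \1_(h n @^-1` [set r]) x)%:E).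
  rewrite -ge0_integral_fsum//; last 2 first.
  - by move=> r; exact/measurable_EFinP/measurable_funM.
  - by move=> r x _; rewrite nnfun_muleindic_ge0.
  by apply: eq_integral => x _; rewrite fsumEFin// -fimfunE.
transitivity (\sum_(r \in range (h n))
    \int[mu]_x ((r * \1_(h n @^-1` [set r]) x)%:E * (g x)%:E)); last first.
  rewrite -ge0_integral_fsum//; last 2 first.
  - by move=> r; apply: emeasurable_funM; apply/measurable_EFinP => //;
      exact: measurable_funM.
  - by move=> r x _; apply: mule_ge0; [exact: nnfun_muleindic_ge0|rewrite lee_fin].
  apply: eq_integral => x _.
  rewrite -ge0_mule_fsuml => [|r]; last exact: nnfun_muleindic_ge0.
  by rewrite fsumEFin// -fimfunE.
apply: eq_fsbigr => r; rewrite inE => -[x _ <-].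
rewrite integralZl_indic_nnsfun// integral_indic// setIT nuE//.
under [RHS]eq_integral do rewrite EFinM -muleA.
rewrite ge0_integralZl//; last 3 first.
- by apply: emeasurable_funM; exact/measurable_EFinP.
- by move=> y _; rewrite mule_ge0 ?lee_fin.
- by rewrite lee_fin.
congr (_ * _); rewrite integral_mkcond; apply: eq_integral => y _.
by rewrite epatch_indic muleC.
Qed.

End Density.

Section Independence.
Local Open Scope ereal_scope.
Context d (T : measurableType d) (R : realType) (P : probability T R).

(** Independence says that the law of (X, Y) agrees with the product of the two
    laws on rectangles, hence everywhere. *)
Lemma ge0_integral_independent (X Y : {RV P >-> R}) (f : R * R -> \bar R) :
  independent_RV X Y -> measurable_fun setT f -> (forall z, 0 <= f z) ->
  \int[P]_w f (X w, Y w) =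
  \int[distribution P X]_x \int[P]_w f (x, Y w).
Proof.
move=> XY mf f0.
have mZ : measurable_fun setT (fun w => (X w, Y w)) by apply: measurable_fun_pair.
pose Z : {mfun T >-> (R * R)%type} :=
  HB.pack (fun w => (X w, Y w)) (isMeasurableFun.Build _ _ _ _ _ mZ).
transitivity (\int[distribution P Z]_z f z).
  by rewrite ge0_integral_distribution.
transitivity (\int[distribution P X \x distribution P Y]_z f z).
  apply: eq_measure_integral => A mA _; apply/esym.
  by apply: product_measure_unique => // B C mB mC; exact: XY.
rewrite fubini_tonelli1//; apply: eq_integral => x _.
rewrite /fubini_F ge0_integral_distribution//.
by apply: measurableT_comp mf _; exact: measurable_pair1.
Qed.

End Independence.

(** * Expected fractional parts *)

Section FractionalParts.
Context d (T : measurableType d) (R : realType) (P : probability T R).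
Local Notation mu := (@lebesgue_measure R).
Local Notation D := (`]0%R, +oo[%classic : set R).

(** Real-valued expectations lose nothing for variables with values in [0, 1];
    this is how [rho] and [htimes] enter extended real-valued integrals. *)
Lemma expectation01E (Z : T -> R) : measurable_fun setT Z ->
  (forall w, 0 <= Z w <= 1) ->
  ((fine 'E_P[Z])%:E = \int[P]_w (Z w)%:E)%E.
Proof.
move=> mZ Z01; rewrite unlock fineK// ge0_fin_numE; last first.
  by apply: integral_ge0 => w _; rewrite lee_fin; case/andP: (Z01 w).
apply: (@le_lt_trans _ _ (\int[P]_w (cst 1%E w))%E).
  apply: ge0_le_integral => //.
  - by move=> w _; rewrite lee_fin; case/andP: (Z01 w).
  - exact/measurable_EFinP.
  - by move=> w _; rewrite lee_fin; case/andP: (Z01 w).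
by rewrite integral_cst//= mul1e probability_setT ltry.
Qed.

Lemma measurable_expectation01 (F : R * T -> R) : measurable_fun setT F ->
  (forall z, 0 <= F z <= 1) ->
  measurable_fun setT (fun t : R => fine 'E_P[fun w => F (t, w)]).
Proof.
move=> mF F01; apply/measurable_EFinP.
have -> : EFin \o (fun t : R => fine 'E_P[fun w => F (t, w)]) =
    (fun t => \int[P]_w (F (t, w))%:E)%E.
  apply/funext => t /=; apply: expectation01E => //.
  exact: measurableT_comp mF (measurable_pair1 _).
apply: (measurable_fun_fubini_tonelli_F (fun z => (F z)%:E)).
  exact/measurable_EFinP.
by move=> z; rewrite lee_fin; case/andP: (F01 z).
Qed.

Lemma frac_part01 (x : R) : 0 <= frac_part x <= 1.
Proof. by rewrite frac_part_ge0 frac_part_le1. Qed.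

Variable Y : {RV P >-> R}.

Let mY : measurable_fun setT (Y : T -> R) := measurable_funPT Y.

Lemma rhoE (t : R) :
  ((rho Y t)%:E = \int[P]_w (frac_part (Y w / t))%:E)%E.
Proof.
apply: expectation01E => [|w]; last exact: frac_part01.
by apply: measurableT_comp; [exact: measurable_frac_part|solve_measurable].
Qed.

Lemma rho_ge0 (t : R) : 0 <= rho Y t.
Proof.
by rewrite -lee_fin rhoE; apply: integral_ge0 => w _; rewrite lee_fin frac_part_ge0.
Qed.

Lemma measurable_rho : measurable_fun setT (rho Y).
Proof.
apply: (@measurable_expectation01 (fun z => frac_part (Y z.2 / z.1))).
  apply: measurableT_comp; first exact: measurable_frac_part.
  by solve_measurable.
by move=> z; exact: frac_part01.
Qed.

Lemma measurable_htimes (X : nat -> {RV P >-> R}) k :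
  measurable_fun setT (htimes Y X k).
Proof.
have mX : measurable_fun setT (X k : T -> R) := measurable_funPT (X k).
apply: (@measurable_expectation01
  (fun z => frac_part (Y z.2 / (X k z.2 * z.1)))).
  apply: measurableT_comp; first exact: measurable_frac_part.
  by solve_measurable; apply: measurableT_comp measurable_snd.
by move=> z; exact: frac_part01.
Qed.

Lemma htimes_ge0 (X : nat -> {RV P >-> R}) k (t : R) : 0 <= htimes Y X k t.
Proof.
rewrite /htimes fine_ge0//; apply: expectation_ge0 => w; exact: frac_part_ge0.
Qed.

(** {y} <= 1 bounds rho x, and {y} <= y bounds x * rho x by the mean of Y. *)
Lemma rho_decay (x : R) : (forall w, 0 <= Y w) ->
  P.-integrable setT (EFin \o Y) -> 0 < x ->
  rho Y x * (1 + x) <= 1 + fine (\int[P]_w (Y w)%:E)%E.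
Proof.
move=> Y0 iY x0; rewrite mulrDr mulr1 lerD//.
  rewrite -lee_fin rhoE; apply: (@le_trans _ _ (\int[P]_w (cst 1%E w))%E).
    apply: ge0_le_integral => //.
    - by move=> w _; rewrite lee_fin frac_part_ge0.
    - apply/measurable_EFinP; apply: measurableT_comp; first exact: measurable_frac_part.
      by solve_measurable.
    - by move=> w _; rewrite lee_fin frac_part_le1.
  by rewrite integral_cst//= mul1e probability_setT.
have iYfin : (\int[P]_w (Y w)%:E)%E \is a fin_num by exact: integrable_fin_num.
rewrite -lee_fin fineK// mulrC EFinM rhoE -ge0_integral_EFinZl//; last 3 first.
- by apply: measurableT_comp; [exact: measurable_frac_part|solve_measurable].
- by move=> w _; exact: frac_part_ge0.
- exact: ltW.
apply: ge0_le_integral => //.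
- by move=> w _; rewrite lee_fin mulr_ge0 ?frac_part_ge0 ?(ltW x0).
- apply/measurable_EFinP; apply: measurable_funM => //.
  by apply: measurableT_comp; [exact: measurable_frac_part|solve_measurable].
- exact/measurable_EFinP.
- move=> w _; rewrite lee_fin mulrC -ler_pdivlMr//.
  by rewrite frac_part_le// divr_ge0// ltW.
Qed.

Lemma gamma_pdfE n : gamma_pdf n.+1%:R = (gamma_density n : R -> R) \_ D.
Proof.
apply/funext => x; rewrite patchE /gamma_pdf.
have -> : (x \in D) = (0 < x) by apply/idP/idP; rewrite inE halflineE.
case: ifPn => // x0; rewrite GammaS /gamma_density -[n.+1%:R]natr1 addrK.
by rewrite powR_mulrn ?ltW// mulrC.
Qed.

(** Conditioning on X = x replaces Y / (X t) by Y / (x t), whose expected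
    fractional part is rho(x t). *)
Lemma htimesE (X : nat -> {RV P >-> R}) n :
  gamma_distributed n.+1%:R (X n.+1) -> independent_RV (X n.+1) Y ->
  forall t, 0 < t ->
  ((htimes Y X n.+1 t)%:E =
   \int[mu]_(x in D) (gamma_density n x * rho Y (x * t))%:E)%E.
Proof.
move=> Xgamma XY t t0.
have mX : measurable_fun setT (X n.+1 : T -> R) := measurable_funPT (X n.+1).
have mr := measurable_rho.
have mg : measurable_fun setT (gamma_pdf n.+1%:R : R -> R).
  rewrite gamma_pdfE; apply: (iffLR (measurable_restrictT _ measurable_halfline)).
  by apply: measurable_funTS; exact: measurable_gamma_density.
rewrite expectation01E; last 2 first.
- by apply: measurableT_comp; [exact: measurable_frac_part|solve_measurable].
- by move=> w; exact: frac_part01.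
rewrite (ge0_integral_independent
  (f := fun z => (frac_part (z.2 / (z.1 * t)))%:E) XY); last 2 first.
- apply/measurable_EFinP.
  by apply: measurableT_comp; [exact: measurable_frac_part|solve_measurable].
- by move=> z; rewrite lee_fin frac_part_ge0.
under eq_integral do rewrite /= -rhoE.
have mrt : measurable_fun setT (fun x : R => (rho Y (x * t))%:E).
  by apply/measurable_EFinP; solve_measurable.
(* The same variable with values in the copy of the real line that carries
   Lebesgue measure, so that its law can have a density with respect to it. *)
have mX' : @measurable_fun _ _ T (measurableTypeR R) setT (X n.+1) by exact: mX.
pose X' : {RV P >-> measurableTypeR R} :=
  HB.pack (X n.+1 : T -> measurableTypeR R) (isMeasurableFun.Build _ _ _ _ _ mX').
transitivity (\int[distribution P X']_x (rho Y (x * t))%:E)%E.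
  by rewrite !ge0_integral_distribution// => x; rewrite lee_fin rho_ge0.
rewrite (ge0_integral_density (mu := mu) mg)//; last 2 first.
- move=> x; rewrite gamma_pdfE patchE; case: ifPn => //.
  by rewrite inE halflineE; exact: gamma_density_ge0.
- by move=> x; rewrite lee_fin rho_ge0.
rewrite [RHS]integral_mkcond; apply: eq_integral => x _.
rewrite gamma_pdfE !patchE; case: ifPn => _; last by rewrite mule0.
by rewrite -EFinM mulrC.
Qed.

End FractionalParts.

(* Besides the identity, the conclusion records that the objects it relates
   are well defined: the two functions lie in L^2(0, oo), and the integrals
   defining A(u) and the right-hand side converge. *)
Theorem proposition1 (R : realType) (d : measure_display)
    (T : measurableType d) (P : probability T R)
    (Y : {RV P >-> R}) (X : nat -> {RV P >-> R})
    (Y_ge0 : forall w, 0 <= Y w)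
    (Y_integrable : P.-integrable setT (EFin \o Y))
    (X_gamma : forall k, (1 <= k)%N -> gamma_distributed k%:R (X k))
    (X_indep : forall k, (1 <= k)%N -> independent_RV (X k) Y)
    (m n : nat) :
  [/\ in_L2 (htimes Y X n.+1) /\ in_L2 (htimes Y X m.+1),
      forall u : R, 0 < u < 1 ->
        (@lebesgue_measure R).-integrable `]0, +oo[
          (fun t => (rho Y (u * t) * rho Y ((1 - u) * t))%:E),
      (@lebesgue_measure R).-integrable `]0, 1[
        (fun u => (bernstein (m + n) n u * rho_autocorr Y u)%:E)
    & scalar_product (htimes Y X n.+1) (htimes Y X m.+1) =
        \int[@lebesgue_measure R]_(u in `]0, 1[)
          (bernstein (m + n) n u * rho_autocorr Y u)].
Proof.
pose r := rho Y.
have mr : measurable_fun setT r := measurable_rho Y.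
have r0 : forall x, 0 <= r x := rho_ge0 Y.
have rd x : 0 < x -> r x * (1 + x) <= 1 + fine (\int[P]_w (Y w)%:E)%E.
  exact: rho_decay.
have mh k : measurable_fun setT (htimes Y X k) by exact: measurable_htimes.
have h0 k t : 0 <= htimes Y X k t by exact: htimes_ge0.
have hE k : forall t, 0 < t -> ((htimes Y X k.+1 t)%:E =
    \int[@lebesgue_measure R]_(x in `]0%R, +oo[)
      (gamma_density k x * r (x * t))%:E)%E.
  by apply: htimesE; [exact: X_gamma|exact: X_indep].
have LE k l := integral_gamma_mixtureM mr r0 (mh l.+1) (h0 l.+1)
  (hE k) (hE l).
have h_L2 k : in_L2 (htimes Y X k.+1).
  split; first exact: measurable_funTS.
  apply/integrableP; split.
    by apply/measurable_EFinP; apply: measurable_funTS; apply: measurable_funX; exact: mh.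
  under eq_integral do rewrite gee0_abs ?lee_fin ?sqr_ge0// expr2.
  by rewrite LE; exact: (bernstein_kernel_form_lty mr r0 rd k k).
have iA u : 0 < u < 1 -> (@lebesgue_measure R).-integrable `]0, +oo[
    (fun t => (r (u * t) * r ((1 - u) * t))%:E).
  exact: (integrable_autocorr mr r0 rd).
have AE u : u \in (`]0, 1[%classic : set R) ->
    ((bernstein (m + n) n u * rho_autocorr Y u)%:E =
    \int[@lebesgue_measure R]_(t in `]0%R, +oo[)
      (bernstein (m + n) n u * (r (u * t) * r ((1 - u) * t)))%:E)%E.
  rewrite inE/= in_itv/= => u01; rewrite ge0_integral_EFinZl//.
  - rewrite EFinM; congr (_ * _)%E.
    by rewrite /rho_autocorr /Rintegral fineK//; exact: (integrable_fin_num _ (iA u u01)).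
  - by apply: measurable_funTS; solve_measurable.
  - by move=> t _; rewrite mulr_ge0.
  - exact: bernstein_ge0.
have RE : (\int[@lebesgue_measure R]_(u in `]0%R, 1%R[)
    (bernstein (m + n) n u * rho_autocorr Y u)%:E =
    \int[@lebesgue_measure R]_(t in `]0%R, +oo[)
      (htimes Y X n.+1 t * htimes Y X m.+1 t)%:E)%E.
  by rewrite LE -integral_bernstein_autocorr//; apply: eq_integral => u; exact: AE.
split=> //.
- apply/integrableP; split.
    apply: (eq_measurable_fun (fun u => \int[@lebesgue_measure R]_(t in `]0%R, +oo[)
      (bernstein (m + n) n u * (r (u * t) * r ((1 - u) * t)))%:E)%E).
      by move=> u u01; rewrite AE.
    apply: (ge0_measurable_fubini_in lebesgue_measure (f := fun z : R * R =>
      (bernstein (m + n) n z.1 * (r (z.1 * z.2) * r ((1 - z.1) * z.2)))%:E)) => //.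
      by have mB := @measurable_bernstein R (m + n) n; solve_measurable.
    move=> u t /=; rewrite in_itv/= => u01 _.
    by rewrite lee_fin; apply: mulr_ge0; [exact: bernstein_ge0|exact: mulr_ge0].
  under eq_integral => u u01.
    rewrite gee0_abs; last first.
      rewrite AE//; apply: integral_ge0 => t _; rewrite lee_fin.
      move: u01; rewrite inE/= in_itv/= => u01.
      by apply: mulr_ge0; [exact: bernstein_ge0|exact: mulr_ge0].
    over.
  by rewrite RE LE; exact: (bernstein_kernel_form_lty mr r0 rd n m).
- by rewrite /scalar_product /Rintegral RE.
Qed.
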